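(* Let $N\ge1$, $p\in[0,1]^N$, $S=\{1,\dots,N\}$, $O=\{j\in S:p_j=0\}$, $I=\{j\in S:p_j=1\}$, $V=S\setminus(I\cup O)$ (all determined by the point $p$ at which derivatives are evaluated). Let $\zeta$ have independent Bernoulli$(p_j)$ entries and $Z=\sum_j\zeta_j$. Let $i\in S$. (a) (Poisson binomial model) For every integer $z$, $$\frac{\partial\,\mathbb P(Z=z)}{\partial p_i}=\begin{cases}\bigl(R(z-|I|-1,V\setminus\{i\})-R(z-|I|,V\setminus\{i\})\bigr)\prod_{j\in V\setminus\{i\}}(1-p_j), & 0\le p_i<1,\\[1ex] \bigl(R(z-|I|,V)-R(z-|I|+1,V)\bigr)\prod_{j\in V}(1-p_j), & p_i=1.\end{cases}$$ (b) (Conditional Bernoulli model) Let $z$ be such that $R(z-|I|,V)>0$ and let $\zeta\in\{0,1\}^N$ satisfy $\sum_j\zeta_j=z$ and $\zeta_j=p_j$ for all $j\in(I\cup O)\setminus\{i\}$. Then $$\frac{\partial\,\mathbb P(\zeta\mid Z=z)}{\partial p_i}=\begin{cases} \mathbb P(\zeta\mid Z=z)\,\dfrac{(1+w_i)^2}{w_i}\Bigl(\zeta_i-\dfrac{w_i\,R(z-|I|-1,V\setminus\{i\})}{R(z-|I|,V)}\Bigr), & 0<p_i<1,\\[2ex] \dfrac{-R(z-|I|-1,V)}{R(z-|I|,V)^2}\displaystyle\prod_{j\in V}w_j^{\zeta_j}, & p_i=0,\ \zeta_i=0,\\[2ex] \dfrac{1}{R(z-|I|,V)}\displaystyle\prod_{j\in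 V}w_j^{\zeta_j}, & p_i=0,\ \zeta_i=1,\\[2ex] \dfrac{-1}{R(z-|I|,V)}\displaystyle\prod_{j\in V}w_j^{\zeta_j}, & p_i=1,\ \zeta_i=0,\\[2ex] \dfrac{R(z-|I|+1,V)}{R(z-|I|,V)^2}\displaystyle\prod_{j\in V}w_j^{\zeta_j}, & p_i=1,\ \zeta_i=1. \end{cases}$$ (c) (Generalized conditional Bernoulli model) Let $\mathcal Z\subseteq\{0,\dots,N\}$ be nonempty with $\mathbb P(Z=z)>0$ for each $z\in\mathcal Z$, and let $\zeta\in\{0,1\}^N$ with $\mathbb P(\zeta\mid Z\in\mathcal Z)>0$. Writing $\mathbb P(z)=\mathbb P(Z=z)$, $$\nabla_p\,\mathbb P(\zeta\mid Z\in\mathcal Z)=\mathbb P(\zeta\mid Z\in\mathcal Z)\left(\frac{\sum_{z\in\mathcal Z}\mathbb P(\zeta\mid Z=z)\nabla_p\mathbb P(z)+\sum_{z\in\mathcal Z}\mathbb P(z)\nabla_p\mathbb P(\zeta\mid Z=z)}{\sum_{z\in\mathcal Z}\mathbb P(\zeta\mid Z=z)\,\mathbb P(z)}-\frac{\sum_{z\in\mathcal Z}\nabla_p\mathbb P(z)}{\sum_{z\in\mathcal Z}\mathbb P(z)}\right).$$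
   Context: For $j$ with $p_j\in[0,1)$, $w_j=\frac{p_j}{1-p_j}$. For an integer $k$ and $A\subseteq S$ on which the weights are defined, $R(k,A)=\sum_{B\subseteq A,|B|=k}\prod_{l\in B}w_l$, with $R(0,A)=1$ and $R(k,A)=0$ for $k<0$ or $k>|A|$. Empty products equal $1$. $\mathbb P(Z=z)$ is the law of the sum; $\mathbb P(\zeta\mid Z=z)$ and $\mathbb P(\zeta\mid Z\in\mathcal Z)$ are the conditional probabilities of the realization $\zeta$ (the conditional Bernoulli and generalized conditional Bernoulli models), all viewed as functions of $p\in[0,1]^N$. Explicitly $\mathbb P(Z=z)=R(z-|I|,V)\prod_{j\in V}(1-p_j)$; $\mathbb P(\zeta\mid Z=z)=\prod_{j\in V}w_j^{\zeta_j}/R(z-|I|,V)$ if $\zeta_j=p_j$ for all $j\in I\cup O$ and $\sum_{j\in V}\zeta_j=z-|I|$, and $0$ otherwise; $\mathbb P(\zeta\mid Z\in\mathcal Z)=\sum_{z\in\mathcal Z}\mathbb P(\zeta\mid Z=z)\mathbb P(z)/\sum_{z\in\mathcal Z}\mathbb P(z)$. At $p_i\in\{0,1\}$ the partial derivative with respect to $p_i$ is one-sided (right derivative at $0$, left derivative at $1$). *)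

(* Defs.v *)
From HB Require Import structures.
From mathcomp Require Import all_boot all_order all_algebra.
From mathcomp Require Import all_classical all_reals all_analysis.

Set Implicit Arguments.
Unset Strict Implicit.
Unset Printing Implicit Defensive.

Import Order.TTheory GRing.Theory Num.Theory.
Import numFieldNormedType.Exports.

Local Open Scope ring_scope.

Section PoissonBinomial.
Context {R : realType} {N : nat}.
Implicit Types (p : 'rV[R]_N) (A : {set 'I_N}) (k z : int).

(* Realizations in {0,1}^N; [true] stands for 1. *)
Definition realization := {ffun 'I_N -> bool}.
Implicit Types (x zeta : realization) (E F : {set realization}).

Definition Oset p : {set 'I_N} := [set j | p 0 j == 0].
Definition Iset p : {set 'I_N} := [set j | p 0 j == 1].
Definition Vset p : {set 'I_N} := ~: (Iset p :|: Oset p).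

(* The odds; only meaningful when p 0 j < 1. *)
Definition w p (j : 'I_N) : R := p 0 j / (1 - p 0 j).

(* R(k, A). The sum is empty, hence 0, when k < 0 or k > #|A|. *)
Definition Rw p k A : R :=
  \sum_(B : {set 'I_N} | (B \subset A) && (#|B|%:Z == k)) \prod_(l in B) w p l.

(* The law of independent Bernoulli(p 0 j) entries on {0,1}^N. *)
Definition Pr p E : R := \sum_(x in E) \prod_j bernoulli_pmf (p 0 j) (x j).

(* Conditional probability; it takes the value 0 when Pr p F = 0. *)
Definition condPr p E F : R := Pr p (E :&: F) / Pr p F.

Definition Zsum x : int := (\sum_j (x j : nat))%N%:Z.

Definition Zeq z : {set realization} := [set x | Zsum x == z].
Definition Zin (ZZ : {set 'I_N.+1}) : {set realization} :=
  [set x | [exists z in ZZ, Zsum x == (z : nat)%:Z]].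

(* P(Z = z), P(zeta | Z = z) and P(zeta | Z \in ZZ) as functions of p: Poisson
   binomial, conditional Bernoulli, generalized conditional Bernoulli. *)
Definition PB z p : R := Pr p (Zeq z).
Definition CB zeta z p : R := condPr p [set zeta] (Zeq z).
Definition GCB zeta (ZZ : {set 'I_N.+1}) p : R := condPr p [set zeta] (Zin ZZ).

(* Partial derivatives of functions on [0,1]^N: two-sided in the i-th
   coordinate when 0 < p 0 i < 1, right derivative at 0, left derivative at 1. *)
Definition increments (t : R) : set_system R :=
  (if t == 0 then 0^'+ else if t == 1 then 0^'- else 0^')%classic.

Definition diffq (f : 'rV[R]_N -> R) p (i : 'I_N) (h : R) : R :=
  h^-1 * (f (h *: delta_mx 0 i + p) - f p).

Definition is_partial (f : 'rV[R]_N -> R) p (i : 'I_N) (l : R) : Prop :=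
  (diffq f p i @ increments (p 0 i) --> l)%classic.

Definition partial (f : 'rV[R]_N -> R) p (i : 'I_N) : R :=
  lim (diffq f p i @ increments (p 0 i))%classic.

Definition is_grad (f : 'rV[R]_N -> R) p (g : 'rV[R]_N) : Prop :=
  forall i, is_partial f p i (g 0 i).

Definition grad (f : 'rV[R]_N -> R) p : 'rV[R]_N := \row_i partial f p i.

End PoissonBinomial.

Arguments realization N : clear implicits.

(* Main.v *)
Require Import Defs.
From mathcomp Require Import all_boot all_order all_algebra.
From mathcomp Require Import all_classical all_reals all_analysis.
From mathcomp Require Import ring.

Import Order.TTheory GRing.Theory Num.Theory.
Import numFieldNormedType.Exports.

Local Open Scope ring_scope.

(* The probability of an event is affine in each p_i: its increment along the
   i-th axis is h times the difference of the probabilities conditioned on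
   zeta_i = 1 and on zeta_i = 0. A conditional probability is therefore a
   quotient of two affine functions of h, whose derivative is explicit and
   two-sided, so it is also the one-sided one at p_i = 0 and p_i = 1.
   Conditioning on zeta_i = b amounts to replacing p_i by b, which removes i
   from V and moves it to I or O; so the two conditional probabilities are given
   by the closed formula for P(Z = z) at the modified parameter. *)

(** * Derivatives of quotients of affine functions *)

Lemma cvg_increments (R : realType) (f : R -> R) (t l : R) :
  (f @ 0^' --> l -> f @ increments t --> l)%classic.
Proof.
rewrite /increments; case: ifP => _; first exact: cvg_dnbhs_at_right.
by case: ifP => _ //; exact: cvg_dnbhs_at_left.
Qed.

(** For [h != 0] close to 0 the difference quotient is exactly
    [(b * c - a * d) / (c * (c + h * d))], and the denominator tends to [c ^+ 2]. *)
Lemma is_partial_fraction (R : realType) (N : nat) (f : 'rV[R]_N -> R)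
    (p : 'rV[R]_N) (i : 'I_N) (a b c d : R) :
  c != 0 ->
  (forall h, f (h *: delta_mx 0 i + p) = (a + h * b) / (c + h * d)) ->
  is_partial f p i ((b * c - a * d) / c ^+ 2).
Proof.
move=> c0 fE; apply: cvg_increments.
have f0 : f p = a / c.
  by rewrite -[p]add0r -(scale0r (delta_mx 0 i)) fE !mul0r !addr0.
have den_cvg : (c + h * d @[h --> (0 : R)^'] --> c)%classic.
  have -> : nbhs c = nbhs (c + 0 * d) by rewrite mul0r addr0.
  apply: cvgD; first exact: cvg_cst.
  by apply: cvgM; [exact: cvg_within | exact: cvg_cst].
have den_neq0 : (\forall h \near (0 : R)^', c + h * d != 0)%classic.
  exact: (cvgr_neq0 c den_cvg c0).
apply: (@cvg_trans _
  ((fun h : R => (b * c - a * d) / (c * (c + h * d))) @ (0 : R)^')%classic).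
  apply: near_eq_cvg; near=> h.
  have h0 : h != 0 by near: h; exact: nbhs_dnbhs_neq.
  have ch0 : c + h * d != 0 by near: h.
  by rewrite /diffq fE f0; field; rewrite h0 c0 ch0.
apply: cvgM; first exact: cvg_cst.
apply: cvgV; first by rewrite mulf_neq0.
by apply: cvgM => //; exact: cvg_cst.
Unshelve. all: by end_near. Qed.

Lemma is_partial_eq (R : realType) (N : nat) (f : 'rV[R]_N -> R)
    (p : 'rV[R]_N) (i : 'I_N) (l : R) :
  is_partial f p i l -> partial f p i = l.
Proof.
rewrite /is_partial /partial /increments; do ?case: ifP => _; exact: cvg_lim.
Qed.

(** * Dependence of probabilities on one coordinate *)

(** Stands for conditioning on the i-th entry being [b], but makes sense also when that event has
    probability 0. *)
Definition fixp {R : realType} {N : nat} (p : 'rV[R]_N) (i : 'I_N) (b : bool) :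
  'rV[R]_N := \row_j (if j == i then b%:R else p 0 j).

Definition dPr {R : realType} {N : nat} (p : 'rV[R]_N) (i : 'I_N)
  (E : {set realization N}) : R := Pr (fixp p i true) E - Pr (fixp p i false) E.

(** In each summand only the factor at [i] depends on the i-th coordinate, and it is affine in it.
    The identity holds for every real [h], even where the shifted parameter leaves the unit cube;
    this makes two-sided limits available at 0 and 1. *)
Lemma Pr_affine (R : realType) (N : nat) (p : 'rV[R]_N) (i : 'I_N)
    (E : {set realization N}) (h : R) :
  Pr (h *: delta_mx 0 i + p) E = Pr p E + h * dPr p i E.
Proof.
rewrite /dPr /Pr -sumrB mulr_sumr -big_split; apply: eq_bigr => x _ /=.
have bern_split (q : 'rV[R]_N) : (forall j, j != i -> q 0 j = p 0 j) ->
    \prod_j bernoulli_pmf (q 0 j) (x j) =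
    bernoulli_pmf (q 0 i) (x i)
    * \prod_(j | j != i) bernoulli_pmf (p 0 j) (x j).
  by move=> qp; rewrite (bigD1 i) //=; congr (_ * _); apply: eq_bigr => j /qp ->.
rewrite !bern_split //.
- rewrite !mxE !eqxx /bernoulli_pmf; case: (x i) => /=; ring.
- by move=> j /negPf ji; rewrite mxE ji.
- by move=> j /negPf ji; rewrite mxE ji.
- by move=> j /negPf ji; rewrite !mxE ji andbF mulr0 add0r.
Qed.

Lemma is_partial_PB (R : realType) (N : nat) (p : 'rV[R]_N) (i : 'I_N)
    (z : int) : is_partial (PB z) p i (dPr p i (Zeq z)).
Proof.
have -> : dPr p i (Zeq z) =
    (dPr p i (Zeq z) * 1 - Pr p (Zeq z) * 0) / 1 ^+ 2.
  by rewrite expr1n mulr0 subr0 mulr1 divr1.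
apply: is_partial_fraction; first exact: oner_neq0.
by move=> h; rewrite mulr0 addr0 divr1 /PB Pr_affine.
Qed.

Lemma is_partial_condPr (R : realType) (N : nat) (p : 'rV[R]_N) (i : 'I_N)
    (E F : {set realization N}) :
  Pr p F != 0 ->
  is_partial (fun q => condPr q E F) p i
    ((dPr p i (E :&: F) * Pr p F - Pr p (E :&: F) * dPr p i F) / Pr p F ^+ 2).
Proof.
by move=> F0; apply: is_partial_fraction => // h; rewrite /condPr !Pr_affine.
Qed.

(** The events [Zeq z] are disjoint: each realization in [Zin ZZ] has its sum equal to exactly one
    [z] in [ZZ]. *)
Lemma Pr_Zin (R : realType) (N : nat) (p : 'rV[R]_N) (E : {set realization N})
    (ZZ : {set 'I_N.+1}) :
  Pr p (E :&: Zin ZZ) = \sum_(z in ZZ) Pr p (E :&: Zeq (z : nat)%:Z).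
Proof.
rewrite /Pr (exchange_big_dep (mem (E :&: Zin ZZ))) /=; last first.
  move=> z x zZ; rewrite !inE => /andP[-> /= xz].
  by apply/existsP; exists z; rewrite zZ.
apply: eq_bigr => x; rewrite !inE => /andP[xE /existsP[z /andP[zZ xz]]].
rewrite (big_pred1 z) // => y; rewrite !inE xE /= (eqP xz).
apply/andP/eqP => [[_ /eqP[]] /val_inj //|->]; by rewrite zZ.
Qed.

Lemma dPr_Zin (R : realType) (N : nat) (p : 'rV[R]_N) (i : 'I_N)
    (E : {set realization N}) (ZZ : {set 'I_N.+1}) :
  dPr p i (E :&: Zin ZZ) = \sum_(z in ZZ) dPr p i (E :&: Zeq (z : nat)%:Z).
Proof. by rewrite /dPr !Pr_Zin -sumrB. Qed.

(** * Closed formulas for point masses and for the law of the sum *)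

(** Factors outside [Vset p] equal 1; inside, [p = w * (1 - p)] and [1 - p = w ^+ 0 * (1 - p)]. *)
Lemma prod_bernoulli_agree (R : realType) (N : nat) (p : 'rV[R]_N)
    (x : realization N) :
  (forall j, j \notin Vset p -> (x j)%:R = p 0 j) ->
  \prod_j bernoulli_pmf (p 0 j) (x j) =
  \prod_(j in Vset p) w p j ^+ x j * \prod_(j in Vset p) (1 - p 0 j).
Proof.
move=> xp; rewrite (bigID (mem (Vset p))) /= [X in _ * X]big1 ?mulr1; last first.
  move=> j jV; rewrite -(xp j jV) /bernoulli_pmf.
  by case: (x j); rewrite ?subr0.
rewrite -big_split; apply: eq_bigr => j /=; rewrite !inE negb_or => /andP[p1 _].
rewrite /bernoulli_pmf /w; case: (x j); rewrite ?expr0 ?mul1r // expr1 divfK //.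
by rewrite subr_eq0 eq_sym.
Qed.

Lemma prod_bernoulli_disagree (R : realType) (N : nat) (p : 'rV[R]_N)
    (x : realization N) (j : 'I_N) :
  j \notin Vset p -> (x j)%:R != p 0 j ->
  \prod_j bernoulli_pmf (p 0 j) (x j) = 0.
Proof.
rewrite !inE negbK => jV xj; rewrite (bigD1 j) //= /bernoulli_pmf.
by case/orP: jV xj => /eqP ->; case: (x j); rewrite ?eqxx ?subrr ?mul0r.
Qed.

Lemma Pr_set1 (R : realType) (N : nat) (p : 'rV[R]_N) (x : realization N) :
  Pr p [set x] = \prod_j bernoulli_pmf (p 0 j) (x j).
Proof. by rewrite /Pr big_set1. Qed.

(** Only realizations that agree with [p] on I and O have mass. They correspond to the subsets B of
    V on which they equal 1, with sum [#|B| + #|Iset p|]; hence the shift by [#|Iset p|]. *)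
Lemma Pr_Zeq (R : realType) (N : nat) (p : 'rV[R]_N) (z : int) :
  Pr p (Zeq z) =
  Rw p (z - #|Iset p|%:Z) (Vset p) * \prod_(j in Vset p) (1 - p 0 j).
Proof.
(* [xof] and [setof] are the two directions of this bijection. *)
pose xof (B : {set 'I_N}) : realization N :=
  [ffun j => (j \in B) || (j \in Iset p)].
pose setof (x : realization N) : {set 'I_N} := [set j in Vset p | x j].
pose agree (x : realization N) :=
  [forall (j | j \notin Vset p), (x j)%:R == p 0 j].
rewrite /Pr (bigID agree) /= [X in _ + X]big1 ?addr0; last first.
  move=> x /andP[_ /forallPn[j]]; rewrite negb_imply => /andP[jV xj].
  exact: (prod_bernoulli_disagree _ _ _ _ j).
rewrite (reindex_onto xof setof) /=; last first.
  move=> x /andP[_ /forallP xp]; apply/ffunP => j; rewrite !ffunE !inE.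
  have := xp j; rewrite !inE negbK.
  case: (eqVneq (p 0 j) 1) => [-> /=|_ /=]; first by rewrite pnatr_eq1 eqb1 => ->.
  case: (eqVneq (p 0 j) 0) => [-> /=|_ _ /=]; last by rewrite orbF.
  by rewrite pnatr_eq0 eqb0 => /negPf ->.
have xofV (B : {set 'I_N}) : B \subset Vset p ->
    forall j, j \in Vset p -> xof B j = (j \in B).
  by move=> BV j; rewrite !inE negb_or ffunE inE => /andP[/negPf -> _];
    rewrite orbF.
have xof_agree (B : {set 'I_N}) : B \subset Vset p -> agree (xof B).
  move=> BV; apply/forallP => j; apply/implyP => jV.
  have /negPf jB : j \notin B by apply: contra jV; exact: (fintype.subsetP BV).
  rewrite ffunE jB /= inE; move: jV; rewrite !inE negbK.
  by case: (eqVneq (p 0 j) 1) => [->//|_ /= /eqP ->].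
rewrite /Rw mulr_suml; apply: eq_big => B.
  case BV: (B \subset Vset p) => /=; last first.
    apply/negP => /andP[_ /eqP EB]; move/negP: BV; apply; rewrite -EB.
    by apply/fintype.subsetP => j; rewrite inE => /andP[].
  have -> : setof (xof B) = B.
    apply/setP => j; rewrite inE; case jV: (j \in Vset p) => /=.
      exact: xofV.
    by apply/esym/negP => /(fintype.subsetP BV); rewrite jV.
  rewrite xof_agree // eqxx !andbT inE /Zsum.
  have -> : (\sum_j xof B j = #|B| + #|Iset p|)%N.
    (* B lies in V, hence is disjoint from I, so the ones of [xof B] are counted by the cardinal of
       the union. *)
    rewrite -[RHS]cardsUI (_ : B :&: Iset p = finset.set0) ?cards0 ?addn0.
      rewrite -sum1_card [RHS]big_mkcond; apply: eq_bigr => j _.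
      by rewrite ffunE finset.in_setU; case: (_ || _).
    apply/setP => j; rewrite !inE; apply/negP => /andP[/(fintype.subsetP BV)].
    by rewrite !inE => /norP[/negPf ->].
  by rewrite PoszD -(inj_eq (addIr (- #|Iset p|%:Z))) addrK.
move=> /andP[/andP[_ /forallP agB] /eqP EB].
have BV : B \subset Vset p.
  by rewrite -EB; apply/fintype.subsetP => j; rewrite inE => /andP[].
rewrite prod_bernoulli_agree; last first.
  move=> j jV; apply/eqP.
  by move/forallP/(_ j)/implyP: (xof_agree B BV) => /(_ jV).
congr (_ * _); rewrite big_mkcond [RHS]big_mkcond; apply: eq_bigr => j _.
case jV: (j \in Vset p); first by rewrite xofV //; case: (j \in B).
by case: ifP => // /(fintype.subsetP BV); rewrite jV.
Qed.

(** * Closed formulas after fixing one coordinate *)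

Lemma eq_Rw (R : realType) (N : nat) (p q : 'rV[R]_N) (k : int)
    (A : {set 'I_N}) :
  {in A, forall j, p 0 j = q 0 j} -> Rw p k A = Rw q k A.
Proof.
move=> pq; apply: eq_bigr => B /andP[/fintype.subsetP BA _].
by apply: eq_bigr => j /BA jA; rewrite /w pq.
Qed.

Lemma Vset_fixp (R : realType) (N : nat) (p : 'rV[R]_N) (i : 'I_N) (b : bool) :
  Vset (fixp p i b) = Vset p :\ i.
Proof.
apply/setP => j; rewrite !inE mxE; case: (eqVneq j i) => //= _.
by rewrite pnatr_eq1 pnatr_eq0; case: b.
Qed.

Lemma card_Iset_fixp (R : realType) (N : nat) (p : 'rV[R]_N) (i : 'I_N)
    (b : bool) :
  #|Iset (fixp p i b)| = (b + #|Iset p :\ i|)%N.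
Proof.
rewrite (cardsD1 i) inE mxE eqxx pnatr_eq1 eqb1; congr (_ + _)%N.
by apply: eq_card => j; rewrite !inE mxE; case: (eqVneq j i).
Qed.

(** Counting I without [i] gives one formula for all values of the i-th coordinate; the fixed entry
    contributes the extra shift [b]. *)
Lemma Pr_fixp_Zeq (R : realType) (N : nat) (p : 'rV[R]_N) (i : 'I_N) (b : bool)
    (z : int) :
  Pr (fixp p i b) (Zeq z) =
  Rw p (z - #|Iset p :\ i|%:Z - b%:Z) (Vset p :\ i)
  * \prod_(j in Vset p :\ i) (1 - p 0 j).
Proof.
rewrite Pr_Zeq Vset_fixp card_Iset_fixp PoszD opprD [- _ - _]addrC addrA.
have fixpE j : j \in Vset p :\ i -> fixp p i b 0 j = p 0 j.
  by rewrite mxE !inE => /andP[/negPf ->].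
by rewrite (eq_Rw _ _ _ p) //; congr (_ * _); apply: eq_bigr => j /fixpE ->.
Qed.

Lemma Pr_fixp_set1 (R : realType) (N : nat) (p : 'rV[R]_N) (i : 'I_N) (b : bool)
    (x : realization N) :
  (forall j, j \in (Iset p :|: Oset p) :\ i -> (x j)%:R = p 0 j) ->
  Pr (fixp p i b) [set x] =
  (x i == b)%:R * (\prod_(j in Vset p :\ i) w p j ^+ x j
                   * \prod_(j in Vset p :\ i) (1 - p 0 j)).
Proof.
move=> xp; rewrite Pr_set1; case: eqP => [xi|/eqP xi]; last first.
  rewrite mul0r; apply: (prod_bernoulli_disagree _ _ _ _ i).
    by rewrite Vset_fixp !inE eqxx.
  by rewrite mxE eqxx eqr_nat; apply: contra xi => /eqP; case: (x i) b => [] [].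
rewrite mul1r prod_bernoulli_agree; last first.
  move=> j; rewrite Vset_fixp mxE; case: (eqVneq j i) => [->|ji]; first by rewrite xi.
  by move=> jV; apply: xp; move: jV; rewrite !inE ji /= negbK.
rewrite Vset_fixp; congr (_ * _); apply: eq_bigr => j; rewrite !inE /w !mxE;
  by case: (eqVneq j i).
Qed.

(** Split the subsets B by whether they contain [i]; those that do are [i |: B'] with B' in
    [A :\ i], and the factor [w p i] comes out. *)
Lemma Rw_recl (R : realType) (N : nat) (p : 'rV[R]_N) (k : int)
    (A : {set 'I_N}) (i : 'I_N) :
  i \in A -> Rw p k A = Rw p k (A :\ i) + w p i * Rw p (k - 1) (A :\ i).
Proof.
move=> iA; rewrite /Rw (bigID (fun B : {set 'I_N} => i \in B)) /= addrC.
congr (_ + _).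
  by apply: eq_bigl => B; rewrite subsetD1 andbAC.
rewrite mulr_sumr (reindex_onto (fun B => i |: B) (fun B => B :\ i)) /=; last first.
  by move=> B /andP[_ iB]; rewrite finset.setD1K.
apply: eq_big => B.
  rewrite finset.setU11 andbT finset.subUset finset.sub1set iA /= cardsU1 subsetD1.
  case iB: (i \in B) => /=.
    rewrite andbF andFb; apply/negP => /andP[_ /eqP EB].
    by move: iB; rewrite -EB !inE eqxx.
  rewrite finset.setU1K ?iB // eqxx !andbT PoszD addrC.
  by rewrite -(inj_eq (addIr (- 1 : int))) addrK.
move=> /andP[_ /eqP EB].
have iB : i \notin B by rewrite -EB !inE eqxx.
by rewrite big_setU1.
Qed.

(** * Explicit slopes and degenerate coordinates *)

Lemma dPr_Zeq (R : realType) (N : nat) (p : 'rV[R]_N) (i : 'I_N) (z : int) :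
  dPr p i (Zeq z) =
  (Rw p (z - #|Iset p :\ i|%:Z - 1) (Vset p :\ i)
   - Rw p (z - #|Iset p :\ i|%:Z) (Vset p :\ i))
  * \prod_(j in Vset p :\ i) (1 - p 0 j).
Proof. by rewrite /dPr !Pr_fixp_Zeq subr0 mulrBl. Qed.

(** One of the two fixed parameters gives the realization mass 0, so only a sign depends on the i-th
    entry. *)
Lemma dPr_set1 (R : realType) (N : nat) (p : 'rV[R]_N) (i : 'I_N)
    (x : realization N) :
  (forall j, j \in (Iset p :|: Oset p) :\ i -> (x j)%:R = p 0 j) ->
  dPr p i [set x] =
  (if x i then 1 else - 1) * (\prod_(j in Vset p :\ i) w p j ^+ x j
                              * \prod_(j in Vset p :\ i) (1 - p 0 j)).
Proof.
by move=> xp; rewrite /dPr !Pr_fixp_set1 //; case: (x i) => /=; ring.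
Qed.

Lemma fixp_id (R : realType) (N : nat) (p : 'rV[R]_N) (i : 'I_N) (b : bool) :
  p 0 i = b%:R -> fixp p i b = p.
Proof. by move=> pi; apply/rowP => j; rewrite mxE; case: eqVneq => [->|]. Qed.

Lemma set1I_Zeq (N : nat) (x : realization N) (z : int) :
  [set x] :&: Zeq z = if Zsum x == z then [set x] else finset.set0.
Proof.
apply/setP => y; rewrite !inE; case: eqVneq => [->|yx] /=.
  by case: ifP => _; rewrite !inE ?eqxx.
by case: ifP => _; rewrite !inE ?(negPf yx).
Qed.

Lemma is_partial_CB (R : realType) (N : nat) (p : 'rV[R]_N) (i : 'I_N)
    (z : int) (x : realization N) :
  Pr p (Zeq z) != 0 -> Zsum x = z ->
  is_partial (CB x z) p i
    ((dPr p i [set x] * Pr p (Zeq z) - Pr p [set x] * dPr p i (Zeq z))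
     / Pr p (Zeq z) ^+ 2).
Proof.
move=> z0 xz; have := is_partial_condPr R N p i [set x] (Zeq z) z0.
by rewrite set1I_Zeq xz eqxx.
Qed.

Lemma prod_Vset_neq0 (R : realType) (N : nat) (p : 'rV[R]_N) (i : 'I_N) :
  \prod_(j in Vset p :\ i) (1 - p 0 j) != 0.
Proof.
apply/prodf_neq0 => j; rewrite !inE negb_or => /and3P[_ p1 _].
by rewrite subr_eq0 eq_sym.
Qed.

Lemma Vset_D1 (R : realType) (N : nat) (p : 'rV[R]_N) (i : 'I_N) (b : bool) :
  p 0 i = b%:R -> Vset p :\ i = Vset p.
Proof.
move=> pi; rewrite -(fixp_id R N p i b pi) Vset_fixp; apply/setP => j.
by rewrite !inE; case: eqVneq.
Qed.

(** * The three derivative formulas *)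

Theorem proposition3p2 (R : realType) (N : nat) (p : 'rV[R]_N)
    (hN : (1 <= N)%N) (hp : forall j, 0 <= p 0 j <= 1) :
  let O := Oset p in
  let I := Iset p in
  let V := Vset p in
  let nI := #|I|%:Z in
  (* (a) *)
  (forall (i : 'I_N) (z : int),
    (0 <= p 0 i < 1 ->
      is_partial (PB z) p i
        ((Rw p (z - nI - 1) (V :\ i) - Rw p (z - nI) (V :\ i))
         * \prod_(j in V :\ i) (1 - p 0 j))) /\
    (p 0 i = 1 ->
      is_partial (PB z) p i
        ((Rw p (z - nI) V - Rw p (z - nI + 1) V)
         * \prod_(j in V) (1 - p 0 j)))) /\
  (* (b) *)
  (forall (i : 'I_N) (z : int) (zeta : realization N),
    0 < Rw p (z - nI) V ->
    Zsum zeta = z ->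
    (forall j, j \in (I :|: O) :\ i -> (zeta j)%:R = p 0 j) ->
    let W := \prod_(j in V) w p j ^+ zeta j in
    (0 < p 0 i < 1 ->
      is_partial (CB zeta z) p i
        (CB zeta z p * ((1 + w p i) ^+ 2 / w p i)
         * ((zeta i)%:R
            - w p i * Rw p (z - nI - 1) (V :\ i) / Rw p (z - nI) V))) /\
    (p 0 i = 0 -> zeta i = false ->
      is_partial (CB zeta z) p i
        (- Rw p (z - nI - 1) V / Rw p (z - nI) V ^+ 2 * W)) /\
    (p 0 i = 0 -> zeta i = true ->
      is_partial (CB zeta z) p i (1 / Rw p (z - nI) V * W)) /\
    (p 0 i = 1 -> zeta i = false ->
      is_partial (CB zeta z) p i (- 1 / Rw p (z - nI) V * W)) /\
    (p 0 i = 1 -> zeta i = true ->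
      is_partial (CB zeta z) p i
        (Rw p (z - nI + 1) V / Rw p (z - nI) V ^+ 2 * W))) /\
  (* (c) *)
  (forall (ZZ : {set 'I_N.+1}) (zeta : realization N),
    ZZ != finset.set0 ->
    (forall z, z \in ZZ -> 0 < PB (z : nat)%:Z p) ->
    0 < GCB zeta ZZ p ->
    let P (z : 'I_N.+1) := PB (z : nat)%:Z in
    let C (z : 'I_N.+1) := CB zeta (z : nat)%:Z in
    (forall z, z \in ZZ -> is_grad (P z) p (grad (P z) p)) /\
    (forall z, z \in ZZ -> is_grad (C z) p (grad (C z) p)) /\
    is_grad (GCB zeta ZZ) p
      (GCB zeta ZZ p *:
        ((\sum_(z in ZZ) C z p * P z p)^-1 *:
           (\sum_(z in ZZ) C z p *: grad (P z) p
            + \sum_(z in ZZ) P z p *: grad (C z) p)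
         - (\sum_(z in ZZ) P z p)^-1 *: \sum_(z in ZZ) grad (P z) p))).
Proof.
move=> O I V nI.
(* The slopes are expressed with [#|I :\ i|]; at a coordinate equal to 1 this is [nI - 1], which
   produces the [+ 1] in the indices of those cases. *)
have nI1 i : p 0 i = 1 -> nI = #|I :\ i|%:Z + 1.
  by move=> pi; rewrite /nI (cardsD1 i) inE pi eqxx addnC PoszD.
have nI_id i : p 0 i != 1 -> nI = #|I :\ i|%:Z.
  by move=> pi; rewrite /nI (cardsD1 i) inE (negPf pi).
split; last split.
- move=> i z; split.
    move=> /andP[_ pi]; rewrite (nI_id i) ?lt_eqF // -dPr_Zeq.
    exact: is_partial_PB.
  move=> pi; have := is_partial_PB R N p i z.
  rewrite dPr_Zeq (Vset_D1 R N p i true) // (nI1 i pi).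
  by rewrite opprD !addrA subrK.
- move=> i z zeta Rgt0 zetaz zetap W.
  have R0 : Rw p (z - nI) V != 0 by rewrite gt_eqF.
  have pi0 := prod_Vset_neq0 R N p i.
  have PrE : Pr p (Zeq z) =
      Rw p (z - nI) V * \prod_(j in V) (1 - p 0 j) := Pr_Zeq R N p z.
  have prod0 : \prod_(j in V) (1 - p 0 j) != 0.
    by apply/prodf_neq0 => j; rewrite !inE negb_or subr_eq0 eq_sym => /andP[].
  have Pr0 : Pr p (Zeq z) != 0 by rewrite PrE mulf_neq0.
  have := is_partial_CB R N p i z zeta Pr0 zetaz.
  rewrite dPr_set1 // dPr_Zeq => dC.
  (* At a degenerate coordinate [p] is its own [fixp], so the mass of [zeta] vanishes exactly when
     its i-th entry disagrees with [p]. *)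
  have Pr1 (b : bool) : p 0 i = b%:R -> Pr p [set zeta] =
      (zeta i == b)%:R * (W * \prod_(j in V) (1 - p 0 j)).
    move=> pib; rewrite -{1}(fixp_id R N p i b pib) Pr_fixp_set1 //.
    by rewrite (Vset_D1 R N p i b).
  do ![split].
  + move=> /andP[p_gt0 p_lt1].
    have iV : i \in V by rewrite !inE negb_or lt_eqF // gt_eqF.
    have q0 : 1 - p 0 i != 0 by rewrite subr_eq0 gt_eqF.
    have p0 : p 0 i != 0 by rewrite gt_eqF.
    have PrS : Pr p [set zeta] = W * \prod_(j in V) (1 - p 0 j).
      rewrite Pr_set1; apply: prod_bernoulli_agree => j jV; apply: zetap.
      have ji : j != i by apply: contraNneq jV => ->.
      by move: jV; rewrite !inE negbK ji.
    have pi1 : p 0 i != 1 by rewrite lt_eqF.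
    have w0 : w p i != 0 by rewrite mulf_neq0 ?invr_eq0.
    (* Eliminates the i-th coordinate in favour of its odds, the variable of the claimed formula. *)
    have qE : 1 - p 0 i = (1 + w p i)^-1.
      by rewrite /w; field; rewrite q0 subrK oner_eq0.
    have w1 : 1 + w p i != 0 by rewrite -invr_eq0 -qE.
    have CBE : CB zeta z p = Pr p [set zeta] / Pr p (Zeq z).
      by rewrite /CB /condPr set1I_Zeq zetaz eqxx.
    apply: (eq_ind _ (is_partial (CB zeta z) p i) dC).
    (* The recursion brings every R to [V :\ i], and the factor at [i] is split off both products
       over V. What remains is a rational identity. *)
    move: R0; rewrite CBE PrS PrE -(nI_id i pi1) (Rw_recl _ _ _ _ _ _ iV).
    rewrite /W !(finset.big_setD1 i iV) /=.
    move: (Rw p _ _) (Rw p _ _) (\prod_(j in _) w p j ^+ _) pi0.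
    move: (\prod_(j in _) _) (w p i) w0 w1 qE => q u w0 w1 qE r1 r0 s q_neq0 R0.
    case: (zeta i) => /=; rewrite ?expr1 ?expr0 qE; field;
      by rewrite q_neq0 w0 w1 R0.
  (* Here [zeta] has mass [W] times the product; the terms containing [Rw p (z - nI) V] cancel in
     the numerator. *)
  + move=> pi zi; apply: (eq_ind _ (is_partial (CB zeta z) p i) dC).
    rewrite -(nI_id i) ?pi ?(eq_sym 0) ?oner_eq0 // (Pr1 false) // PrE.
    rewrite (Vset_D1 R N p i false) // -/V -/W zi /=.
    by field; rewrite R0 prod0.
  (* [zeta] has mass 0, so only the slope of the numerator survives; the next case is the same with
     opposite sign. *)
  + move=> pi zi; apply: (eq_ind _ (is_partial (CB zeta z) p i) dC).
    rewrite (Pr1 false) // PrE (Vset_D1 R N p i false) // -/V -/W zi /=.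
    by field; rewrite R0 prod0.
  + move=> pi zi; apply: (eq_ind _ (is_partial (CB zeta z) p i) dC).
    rewrite (Pr1 true) // PrE (Vset_D1 R N p i true) // -/V -/W zi /=.
    by field; rewrite R0 prod0.
  + move=> pi zi; apply: (eq_ind _ (is_partial (CB zeta z) p i) dC).
    have -> : z - #|I :\ i|%:Z - 1 = z - nI by rewrite (nI1 i pi) opprD addrA.
    have -> : z - #|I :\ i|%:Z = z - nI + 1.
      by rewrite (nI1 i pi) opprD addrA subrK.
    rewrite (Pr1 true) // PrE (Vset_D1 R N p i true) // -/V -/W zi /=.
    by field; rewrite R0 prod0.
- move=> ZZ zeta _ Pgt0 Ggt0 P C.
  have dP i z : partial (P z) p i = dPr p i (Zeq (z : nat)%:Z).
    exact/is_partial_eq/is_partial_PB.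
  have dC z i (zZ : z \in ZZ) : is_partial (C z) p i _ :=
    is_partial_condPr R N p i [set zeta] _ (lt0r_neq0 (Pgt0 z zZ)).
  split; first by move=> z zZ i; rewrite mxE dP; exact: is_partial_PB.
  split.
    move=> z zZ i; rewrite mxE (is_partial_eq _ _ _ _ _ _ (dC z i zZ)).
    exact: dC.
  move=> i; rewrite !mxE.
  (* Since [0^-1 = 0], a nonzero quotient forces both numerator and denominator to be nonzero. *)
  have : Pr p ([set zeta] :&: Zin ZZ) / Pr p (Zin ZZ) != 0 := lt0r_neq0 Ggt0.
  rewrite mulf_eq0 invr_eq0 negb_or => /andP[a0 c0].
  have := is_partial_condPr R N p i [set zeta] (Zin ZZ) c0.
  (* Intersecting with the full set lets the decomposition over [ZZ] apply to [Zin ZZ] itself. *)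
  have setTI_Zin : Zin ZZ = [set: realization N] :&: Zin ZZ.
    by rewrite finset.setTI.
  have PrZ : Pr p (Zin ZZ) = \sum_(z in ZZ) P z p.
    rewrite setTI_Zin Pr_Zin; apply: eq_bigr => z _.
    by rewrite finset.setTI.
  have dPrZ : dPr p i (Zin ZZ) = \sum_(z in ZZ) grad (P z) p 0 i.
    rewrite setTI_Zin dPr_Zin; apply: eq_bigr => z _.
    by rewrite finset.setTI mxE dP.
  have CP : \sum_(z in ZZ) C z p * P z p = Pr p ([set zeta] :&: Zin ZZ).
    rewrite Pr_Zin; apply: eq_bigr => z zZ.
    by rewrite /C /CB /condPr divfK // lt0r_neq0 // Pgt0.
  (* The product rule for [C z p * P z p], the probability of [zeta] together with [Zeq z], summed
     over [ZZ]. *)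
  have dCP : \sum_(z in ZZ) C z p * grad (P z) p 0 i
      + \sum_(z in ZZ) P z p * grad (C z) p 0 i =
      dPr p i ([set zeta] :&: Zin ZZ).
    rewrite dPr_Zin -big_split; apply: eq_bigr => z zZ /=.
    rewrite !mxE dP (is_partial_eq _ _ _ _ _ _ (dC z i zZ)).
    have := lt0r_neq0 (Pgt0 z zZ); rewrite /C /P /CB /condPr /PB => Pz0.
    by field.
  move=> dG; apply: (eq_ind _ (is_partial (GCB zeta ZZ) p i) dG).
  rewrite CP !summxE -PrZ -dPrZ /GCB /condPr.
  under [X in _ * (_ * (X + _) - _)]eq_bigr do rewrite mxE.
  under [X in _ * (_ * (_ + X) - _)]eq_bigr do rewrite mxE.
  (* What remains is the quotient rule in logarithmic form,
     [(a / c)' = (a / c) * (a' / a - c' / c)]. *)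
  rewrite dCP; field.
  by rewrite a0 c0.
Qed.
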